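(* Let $C: f(x,y)=0$ be a reduced plane curve over $\mathbb{C}$ and let $P$ be a multiple ordinary point of multiplicity $m$ (with $m\ge 2$) of $C$. Let $Z_P$ be the Milnor scheme of $C$ at $P$ and $X_P$ the Jacobian scheme of $C$ at $P$. Then: (i) the tangent cones at $P$ of the derivative curves $C_x: f_x=0$ and $C_y: f_y=0$ have no lines in common, hence $Z_P=(C_x\cap C_y)_P$ is an $(m-1)$-slci; (ii) $X_P$ is an $(m-1)$-symmetric scheme.
   Context: For a reduced curve $C:f(x,y)=0$ in $\mathbb{A}^2_{\mathbb{C}}$, the Jacobian scheme is the subscheme of $\mathbb{A}^2$ defined by the ideal $(f,f_x,f_y)$ and the Milnor scheme is the subscheme defined by $(f_x,f_y)$. For a scheme $Y$ and an isolated point $P$ of its support, $Y_P$ denotes the component of $Y$ supported at $P$; $X_P$ and $Z_P$ are the components at $P$ of the Jacobian and Milnor schemes (a singular point of a reduced curve is an isolated point of both). A multiple ordinary point of multiplicity $m$ of $C$ is a (singular) point of multiplicity $m$ at which the tangent cone of $C$ consists of $m$ distinct lines. The length of a $0$-dimensional scheme is denoted $\ell$. A $0$-dimensional scheme $Y$ supported at one point $P$ of the plane is called $k$-symmetric if $\ell(Y\cap r)=k$ for every line $r$ passing through $P$. It is called a $k$-symmetric local complete intersection ($k$-slci) if it is the local complete intersection at $P$, $Y=(D\cap E)_P$, of two plane curves $D,E$, both of multiplicity $k$ at $P$ and with no tangent in common at $P$ (this implies $\ell(Y)=k^2$). *)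

(* Defs.v *)
From HB Require Import structures.
From mathcomp Require Import all_boot all_order all_algebra.
From mathcomp Require Import reals complex mpoly.

Set Implicit Arguments.
Unset Strict Implicit.
Unset Printing Implicit Defensive.

Import GRing.Theory.
Local Open Scope ring_scope.

Notation poly2 K := {mpoly K[2]}.
Notation point2 K := ('I_2 -> K).

(* Closed subschemes of the affine plane over K correspond to the ideals of
   K[x, y]. *)
Record subscheme (K : fieldType) := Subscheme {
  ideal_of :> poly2 K -> Prop;
  ideal_of0 : ideal_of 0;
  ideal_ofD : forall g h, ideal_of g -> ideal_of h -> ideal_of (g + h);
  ideal_ofM : forall g h, ideal_of h -> ideal_of (g * h)
}.

Section Subschemes.
Variable K : fieldType.
Implicit Types (f g h : poly2 K) (P Q : point2 K) (Y Z : subscheme K).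

Definition eq_subscheme Y Z : Prop := forall g, Y g <-> Z g.

Definition gen_ideal (s : seq (poly2 K)) g : Prop :=
  exists c : 'I_(size s) -> poly2 K, g = \sum_(i < size s) c i * s`_i.

Fact gen_ideal0 s : gen_ideal s 0.
Proof. by exists (fun=> 0); rewrite big1 // => i _; rewrite mul0r. Qed.

Fact gen_idealD s g h : gen_ideal s g -> gen_ideal s h -> gen_ideal s (g + h).
Proof.
move=> [c ->] [d ->]; exists (fun i => c i + d i).
by rewrite -big_split; apply: eq_bigr => i _; rewrite mulrDl.
Qed.

Fact gen_idealM s g h : gen_ideal s h -> gen_ideal s (g * h).
Proof.
move=> [c ->]; exists (fun i => g * c i).
by rewrite mulr_sumr; apply: eq_bigr => i _; rewrite mulrA.
Qed.

Definition zero_scheme s : subscheme K :=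
  Subscheme (gen_ideal0 s) (@gen_idealD s) (@gen_idealM s).

Definition add_ideal Y Z g : Prop := exists a b, [/\ Y a, Z b & g = a + b].

Fact add_ideal0 Y Z : add_ideal Y Z 0.
Proof. by exists 0, 0; split; [exact: ideal_of0..|rewrite addr0]. Qed.

Fact add_idealD Y Z g h :
  add_ideal Y Z g -> add_ideal Y Z h -> add_ideal Y Z (g + h).
Proof.
move=> [a [b [Ya Zb ->]]] [c [d [Yc Zd ->]]].
by exists (a + c), (b + d); split; [exact: ideal_ofD..|rewrite addrACA].
Qed.

Fact add_idealM Y Z g h : add_ideal Y Z h -> add_ideal Y Z (g * h).
Proof.
move=> [a [b [Ya Zb ->]]].
by exists (g * a), (g * b); split; [exact: ideal_ofM..|rewrite mulrDr].
Qed.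

Definition inter Y Z : subscheme K :=
  Subscheme (add_ideal0 Y Z) (@add_idealD Y Z) (@add_idealM Y Z).

(* The kernel of K[x, y] -> O_P / I O_P, where O_P is the local ring of the
   plane at P and I is the ideal of Y.  When P is an isolated point of Y this
   is the P-primary component of I. *)
Definition loc_ideal Y P g : Prop := exists h, h.@[P] != 0 /\ Y (h * g).

Fact loc_ideal0 Y P : loc_ideal Y P 0.
Proof.
by exists 1; rewrite mulr0 meval1 oner_neq0; split=> //; apply: ideal_of0.
Qed.

Fact loc_idealD Y P g h :
  loc_ideal Y P g -> loc_ideal Y P h -> loc_ideal Y P (g + h).
Proof.
move=> [a [aP Ya]] [b [bP Yb]]; exists (a * b).
rewrite mevalM mulf_neq0 // mulrDr; split=> //.
apply: ideal_ofD; last by rewrite -mulrA; apply: ideal_ofM.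
by rewrite (mulrC a) -mulrA; apply: ideal_ofM.
Qed.

Fact loc_idealM Y P g h : loc_ideal Y P h -> loc_ideal Y P (g * h).
Proof.
by move=> [a [aP Ya]]; exists a; rewrite mulrCA; split=> //; apply: ideal_ofM.
Qed.

Definition component Y P : subscheme K :=
  Subscheme (loc_ideal0 Y P) (@loc_idealD Y P) (@loc_idealM Y P).

Definition reduced Y : Prop := forall g n, Y (g ^+ n) -> Y g.

(* The classes of the b`_i form a basis of K[x, y] / I. *)
Definition has_length Y (n : nat) : Prop :=
  exists b : n.-tuple (poly2 K),
    forall g, exists! c : 'rV[K]_n, Y (g - \sum_(i < n) c 0 i *: b`_i).

Definition supported_at Y P : Prop :=
  forall Q, (forall g, Y g -> g.@[Q] = 0) <-> Q =1 P.

Definition zero_dim_at Y P : Prop :=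
  (exists n, has_length Y n) /\ supported_at Y P.

Definition curve f : subscheme K := zero_scheme [:: f].

Definition is_curve f : bool := (1 < msize f)%N.

Definition f_x f : poly2 K := f^`M(ord0).
Definition f_y f : poly2 K := f^`M(ord_max).

Definition jacobian_scheme f : subscheme K := zero_scheme [:: f; f_x f; f_y f].
Definition milnor_scheme f : subscheme K := zero_scheme [:: f_x f; f_y f].

(* f(P + X) and f(X - P) *)
Definition recenter f P : poly2 K := f \mPo [tuple 'X_i + (P i)%:MP | i < 2].
Definition uncenter f P : poly2 K := f \mPo [tuple 'X_i - (P i)%:MP | i < 2].

(* The least degree of a monomial of f(P + X): monomials are ordered by degree
   first.  Only meaningful for f != 0. *)
Definition mult f P : nat := mdeg (mlast (recenter f P)).

(* An equation of the tangent cone at P. *)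
Definition tangent_cone f P : poly2 K :=
  uncenter (pihomog mdeg (mult f P) (recenter f P)) P.

(* For a != 0, an equation of the line through P with normal vector a. *)
Definition line_eq P (a : 'rV[K]_2) : poly2 K :=
  \sum_(i < 2) a 0 i *: ('X_i - (P i)%:MP).

Definition same_line (a b : 'rV[K]_2) : Prop := exists2 c, c != 0 & a = c *: b.

Definition has_line f P (a : 'rV[K]_2) : Prop :=
  exists q, f = q * line_eq P a.

Definition no_common_tangent f g P : Prop :=
  forall a, a != 0 ->
    ~ (has_line (tangent_cone f P) P a /\ has_line (tangent_cone g P) P a).

(* The tangent cone is, as a curve, the union of m distinct lines. *)
Definition ordinary_point f P (m : nat) : Prop :=
  mult f P = m /\
  exists (c : K) (a : 'I_m -> 'rV[K]_2),
    [/\ c != 0, forall i, a i != 0,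
        forall i j, i != j -> ~ same_line (a i) (a j)
      & tangent_cone f P = c *: \prod_(i < m) line_eq P (a i)].

Definition symmetric_at (k : nat) Y P : Prop :=
  zero_dim_at Y P /\
  forall a, a != 0 -> has_length (inter Y (curve (line_eq P a))) k.

Definition slci_at (k : nat) Y P : Prop :=
  zero_dim_at Y P /\
  exists d e : poly2 K,
    [/\ is_curve d /\ is_curve e, mult d P = k /\ mult e P = k,
        no_common_tangent d e P
      & eq_subscheme Y (component (inter (curve d) (curve e)) P)].

End Subschemes.

(* Main.v *)
Require Import Defs.
From HB Require Import structures.
From mathcomp Require Import all_boot all_order all_algebra.
From mathcomp Require Import boolp reals complex mpoly.
From mathcomp Require Import ring.

(** Write m = n + 1, let M be the maximal ideal of P, and let F_0, F_1 be the
    two partial derivatives of f.  Modulo M^(m+1), f is a constant times a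
    product of m pairwise independent linear forms l_i centred at P; hence F_j
    is, modulo M^m, the j-th derivative T_j of that product, which is a
    combination of the cofactors G_i = prod_(k != i) l_k whose coefficients are
    the coefficients of the l_i.

    Tangent cones.  On the line through P with direction d, T_j restricts to a
    multiple [slope] of t^n.  The two slopes cannot both vanish ([slope_neq0]):
    if d lies on the line l_i = 0, only the term of G_i survives, with the j-th
    coefficient of l_i in front; otherwise Euler's identity gives a
    combination of the slopes equal to m times the product of the l_i at d.
    So T_0 and T_1 share no line, and being nonzero and homogeneous of degree n
    they are the tangent cones of F_0 and F_1.

    Finite length.  Let J be an ideal containing F_0 and F_1.  Modulo M^(2n+1)
    the ideal J contains G_i G_j for i != j, because this product is a multiple
    of prod l_k, which Euler's identity puts in J + M^(m+1); then it contains
    G_i^2, because G_i T_j is a multiple of G_i^2 plus such mixed products.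
    The cofactors of m independent lines generate M^n ([cofactor_ideal]), so
    M^(2n) lies in J + M^(2n+1) ([fat_point_sub_jets]), and Nakayama's lemma
    puts M^(2n) in the component of J at P.

    Line sections.  Restricting to a line through P identifies the coordinate
    ring of the line with K[t].  Every element of the Jacobian ideal lies in
    M^n, hence restricts to a multiple of t^n, and one of F_0, F_1 restricts to
    t^n times a local unit.  The component therefore cuts the line in the scheme
    t^n = 0, of length n ([line_section_length]). *)

Set Implicit Arguments.
Unset Strict Implicit.
Unset Printing Implicit Defensive.

Import GRing.Theory.
Local Open Scope ring_scope.

(** * Ideals and components *)

Section Ideals.
Variable K : fieldType.
Implicit Types (g h : poly2 K) (Y Z : subscheme K) (P : point2 K).

Lemma ideal_ofN Y g : Y g -> Y (- g).
Proof. by rewrite -mulN1r; apply: ideal_ofM. Qed.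

Lemma ideal_ofB Y g h : Y g -> Y h -> Y (g - h).
Proof. by move=> Yg Yh; apply/ideal_ofD/ideal_ofN. Qed.

Lemma ideal_ofMr Y g h : Y g -> Y (g * h).
Proof. by rewrite mulrC; apply: ideal_ofM. Qed.

Lemma ideal_ofZ Y (c : K) g : Y g -> Y (c *: g).
Proof. by rewrite -mul_mpolyC; apply: ideal_ofM. Qed.

Lemma ideal_of_sum Y (I : Type) (r : seq I) (A : pred I) (F : I -> poly2 K) :
  (forall i, A i -> Y (F i)) -> Y (\sum_(i <- r | A i) F i).
Proof.
move=> YF; elim/big_ind: _ => //; first exact: ideal_of0.
exact: ideal_ofD.
Qed.

Lemma ideal_of_sum_seq Y (I : eqType) (r : seq I) (F : I -> poly2 K) :
  (forall i, i \in r -> Y (F i)) -> Y (\sum_(i <- r) F i).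
Proof. by move=> YF; rewrite big_seq; apply: ideal_of_sum. Qed.

Lemma inter_sub Y Z I : (forall g, Y g -> ideal_of I g) ->
  (forall g, Z g -> I g) -> forall g, inter Y Z g -> I g.
Proof. by move=> YI ZI _ [a [b [/YI Ia /ZI Ib ->]]]; apply: ideal_ofD. Qed.

Lemma inter_l Y Z g : Y g -> inter Y Z g.
Proof.
by move=> Yg; exists g, 0; rewrite addr0; split=> //; apply: ideal_of0.
Qed.

Lemma inter_r Y Z g : Z g -> inter Y Z g.
Proof.
by move=> Zg; exists 0, g; rewrite add0r; split=> //; apply: ideal_of0.
Qed.

Lemma zero_scheme_mem (s : seq (poly2 K)) g : g \in s -> zero_scheme s g.
Proof.
move=> /[dup] gs; rewrite -index_mem => lt_gs.
exists (fun i => (i == Ordinal lt_gs)%:R).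
rewrite (bigD1 (Ordinal lt_gs)) //= eqxx mul1r nth_index // big1 ?addr0 //.
by move=> i /negPf->; rewrite mul0r.
Qed.

Lemma zero_scheme_sub (s : seq (poly2 K)) Y :
  (forall g, g \in s -> Y g) -> forall g, zero_scheme s g -> Y g.
Proof.
move=> sY _ [c ->]; apply: ideal_of_sum => i _.
by apply/ideal_ofM/sY/mem_nth.
Qed.

Lemma sub_component Y P g : Y g -> component Y P g.
Proof. by move=> Yg; exists 1; rewrite meval1 oner_neq0 mul1r. Qed.

Lemma component_sub Y Z P : (forall g, Y g -> Z g) ->
  forall g, component Y P g -> component Z P g.
Proof. by move=> YZ g [h [hP /YZ Zhg]]; exists h. Qed.

Fact colon0 Y h : Y (0 * h).
Proof. by rewrite mul0r; apply: ideal_of0. Qed.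
Fact colonD Y h g1 g2 : Y (g1 * h) -> Y (g2 * h) -> Y ((g1 + g2) * h).
Proof. by rewrite mulrDl; apply: ideal_ofD. Qed.
Fact colonM Y h g1 g2 : Y (g2 * h) -> Y (g1 * g2 * h).
Proof. by rewrite -mulrA; apply: ideal_ofM. Qed.

(** Colon ideals (Y : h) let a containment be tested one factor at a time:
    membership of g * h in Y becomes membership of g in another ideal. *)
Definition colon Y h : subscheme K :=
  Subscheme (colon0 Y h) (@colonD Y h) (@colonM Y h).

End Ideals.

(** * Powers of the maximal ideal of a point *)

Section FatPoints.
Variables (K : fieldType) (P : point2 K).
Implicit Types (g h : poly2 K) (Y Z : subscheme K).

Definition coor (i : 'I_2) : poly2 K := 'X_i - (P i)%:MP.

(** The n-th power of the maximal ideal of P.  The recursive form makes every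
    statement about it an induction that peels off one linear factor. *)
Fixpoint fat_ideal n g : Prop :=
  if n is n'.+1 then
    exists a : 'I_2 -> poly2 K,
      (forall i, fat_ideal n' (a i)) /\ g = \sum_i a i * coor i
  else True.

Fact fat_ideal0 n : fat_ideal n 0.
Proof.
elim: n => //= n IHn; exists (fun=> 0); split=> //.
by rewrite big1 // => i _; rewrite mul0r.
Qed.

Fact fat_idealD n g h : fat_ideal n g -> fat_ideal n h -> fat_ideal n (g + h).
Proof.
elim: n g h => //= n IHn _ _ [a [na ->]] [b [nb ->]].
exists (fun i => a i + b i); split=> [i|]; first exact: IHn.
by rewrite -big_split; apply: eq_bigr => i _; rewrite mulrDl.
Qed.

Fact fat_idealM n g h : fat_ideal n h -> fat_ideal n (g * h).
Proof.
elim: n h => //= n IHn _ [a [na ->]].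
exists (fun i => g * a i); split=> [i|]; first exact: IHn.
by rewrite mulr_sumr; apply: eq_bigr => i _; rewrite mulrA.
Qed.

Definition fat_point n : subscheme K :=
  Subscheme (fat_ideal0 n) (@fat_idealD n) (@fat_idealM n).

Lemma fat_point_coor n g i : fat_point n g -> fat_point n.+1 (g * coor i).
Proof.
move=> ng; exists (fun j => if j == i then g else 0); split=> [j|].
  by case: eqP => // _; apply: fat_ideal0.
by rewrite (bigD1 i) //= eqxx big1 ?addr0 // => j /negPf->; rewrite mul0r.
Qed.

Lemma fat_point_leq n k g : (n <= k)%N -> fat_point k g -> fat_point n g.
Proof.
elim: k n g => [|k IHk] [|n] g //= le_nk [a [ka ->]].
apply: (ideal_of_sum (Y := fat_point n.+1)) => i _.
by apply: fat_point_coor; apply: IHk.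
Qed.

Lemma fat_point_prod_ind n k Y :
    (forall g h, fat_point n g -> fat_point k h -> Y (g * h)) ->
  forall g, fat_point (n + k) g -> Y g.
Proof.
elim: n Y => [|n IHn] Y nkY g.
  by move=> kg; rewrite -[g]mul1r; exact: (nkY 1 g).

case=> a [nka ->]; apply: ideal_of_sum => i _.
apply: (IHn (colon Y (coor i))) (nka i) => g1 h ng kh /=.
by rewrite mulrAC; apply: nkY => //; apply: fat_point_coor.
Qed.

Lemma fat_pointM n k g h :
  fat_point n g -> fat_point k h -> fat_point (n + k) (g * h).
Proof.
elim: n g => [|n IHn] g.
  by move=> _ kh; apply: (ideal_ofM (s := fat_point k)).
move=> [a [na ->]] kh; rewrite mulr_suml; apply: ideal_of_sum => i _.
by rewrite mulrAC; apply: fat_point_coor; apply: IHn => //; apply: na.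
Qed.

Lemma coor_eval i : (coor i).@[P] = 0.
Proof. by rewrite mevalB mevalXU mevalC subrr. Qed.

Lemma fat_point_eval n g : (0 < n)%N -> fat_point n g -> g.@[P] = 0.
Proof.
case: n => // n _ [a [_ ->]]; rewrite raddf_sum big1 //= => i _.
by rewrite mevalM coor_eval mulr0.
Qed.

Lemma fat_point1P g : fat_point 1 (g - (g.@[P])%:MP).
Proof.
elim/mpolyind: g => [|c m g _ _ IHg].
  by rewrite meval0 mpolyC0 subrr; apply: fat_ideal0.
have -> : c *: 'X_[m] + g - ((c *: 'X_[m] + g).@[P])%:MP =
   c *: ('X_[m] - (('X_[m]).@[P])%:MP) + (g - (g.@[P])%:MP).
  by rewrite mevalD mevalZ mpolyCD mpolyCM mul_mpolyC scalerBr addrACA opprD.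
apply: ideal_ofD => //; apply: ideal_ofZ; rewrite mpolyXE_id.
have XP (i : 'I_2) : fat_point 1 ('X_i - (('X_i).@[P])%:MP).
  by rewrite mevalXU -[_ - _]mul1r; apply: fat_point_coor.
have MP a b :
    fat_point 1 (a - (a.@[P])%:MP) -> fat_point 1 (b - (b.@[P])%:MP) ->
    fat_point 1 (a * b - ((a * b).@[P])%:MP).
  move=> Ha Hb; have -> : a * b - ((a * b).@[P])%:MP =
     b * (a - (a.@[P])%:MP) + (a.@[P])%:MP * (b - (b.@[P])%:MP).
    by rewrite mevalM mpolyCM; ring.
  by apply: ideal_ofD; apply: ideal_ofM.
have P1 : fat_point 1 (1 - (1.@[P])%:MP).
  by rewrite meval1 mpolyC1 subrr; apply: fat_ideal0.
apply: (big_ind (fun y => fat_point 1 (y - (y.@[P])%:MP))) => // i _.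
by elim: (m i) => [|k IHk]; [rewrite expr0 | rewrite exprS; apply: MP].
Qed.

Lemma fat_pointS_split n g h : fat_point n h ->
  exists2 r, fat_point n.+1 r & g * h = g.@[P] *: h + r.
Proof.
move=> nh; exists ((g - (g.@[P])%:MP) * h).
  by rewrite -add1n; apply: fat_pointM => //; apply: fat_point1P.
by rewrite mulrBl mul_mpolyC addrC subrK.
Qed.

(** The generators are the 2 ^ n words of length n in the two coordinates;
    the repetitions are harmless and keep the induction a block
    decomposition. *)
Lemma fat_point_fingen n : exists d (w : 'cV[poly2 K]_d),
  (forall i, fat_point n (w i 0)) /\
  forall g, fat_point n g -> exists a : 'rV_d, g = (a *m w) 0 0.
Proof.
elim: n => [|n [d [w [nw wP]]]].
  exists 1%N, 1; split=> // g _; exists g%:M.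
  by rewrite mulmx1 mxE eqxx mulr1n.
exists (d + d)%N, (col_mx (coor ord0 *: w) (coor ord_max *: w)); split=> [i|].
  rewrite mxE; case: split => j; rewrite mxE mulrC; exact: fat_point_coor.
move=> _ [a [na ->]].
have [b0 Db0] := wP _ (na ord0); have [b1 Db1] := wP _ (na ord_max).
exists (row_mx b0 b1); rewrite mul_row_col -!scalemxAr !mxE.
rewrite big_ord_recl big_ord1 (_ : lift _ _ = ord_max); last exact/val_inj.
by rewrite Db0 Db1 !mxE mulrC [in X in _ + X]mulrC.
Qed.

(** The generators w of M^n satisfy (1 - A) w in Y with the entries of A in M.
    Multiplying by the adjugate of 1 - A shows that D = det (1 - A) sends
    M^n into Y, and D takes the value 1 at P. *)
Lemma nakayama n Y :
    (forall g, fat_point n g -> inter Y (fat_point n.+1) g) ->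
  forall g, fat_point n g -> component Y P g.
Proof.
move=> nY; have [d [w [nw wP]]] := fat_point_fingen n.
have /fin_all_exists[A AP] i : exists A : 'rV_d,
    (forall j, (A 0 j).@[P] = 0) /\ Y (w i 0 - (A *m w) 0 0).
  have [a [b [Ya [c [nc Db]] ->]]] := nY _ (nw i).
  have /fin_all_exists[e eP] j : exists e : 'rV_d, c j = (e *m w) 0 0.
    exact/wP/nc.
  exists (\sum_j coor j *: e j); split=> [j|].
    rewrite summxE raddf_sum big1 // => k _.
    by rewrite mxE /= mevalM coor_eval mul0r.
  rewrite mulmx_suml summxE Db -addrA -sumrB big1 ?addr0 // => j _.
  by rewrite -scalemxAl mxE eP mulrC subrr.
(* 1 - A is the identity at P, where all entries of A vanish. *)
pose M := 1%:M - \matrix_i A i; pose D := \det M.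
have DP : D.@[P] = 1.
  rewrite -det_map_mx -[RHS](det1 _ d); congr (\det _).
  apply/matrixP=> i j; rewrite /M !mxE /= mevalB (AP i).1 subr0.
  by rewrite raddfMn /= meval1.
have Yw i : Y (D * w i 0).
  have -> : D * w i 0 = (\adj M *m (M *m w)) i 0.
    by rewrite mulmxA mul_adj_mx mul_scalar_mx mxE.
  rewrite mxE; apply: ideal_of_sum => j _; apply: ideal_ofM.
  have := (AP j).2; congr (ideal_of Y _).
  rewrite mulmxBl mul1mx !mxE; congr (_ - _).
  by apply: eq_bigr => k _; rewrite !mxE.
move=> g /wP[a ->]; exists D; rewrite DP oner_neq0; split=> //.
rewrite mxE mulr_sumr; apply: ideal_of_sum => i _.
by rewrite mulrCA; apply: ideal_ofM.
Qed.

End FatPoints.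

(** * Finite length *)

Section Length.
Variables (K : fieldType) (P : point2 K).
Implicit Types (g h : poly2 K) (Y Z : subscheme K).

(** Independence modulo Y is what turns the existence of coordinates into
    their uniqueness. *)
Lemma has_lengthP Y n (b : 'I_n -> poly2 K) :
    (forall c : 'rV_n, Y (\sum_i c 0 i *: b i) -> c = 0) ->
    (forall g, exists c : 'rV_n, Y (g - \sum_i c 0 i *: b i)) ->
  has_length Y n.
Proof.
move=> b_free b_gen; exists [tuple b i | i < n] => g.
have bE (c : 'rV_n) :
    \sum_(i < n) c 0 i *: [tuple b i | i < n]`_i = \sum_i c 0 i *: b i.
  by apply: eq_bigr => i _; rewrite nth_mktuple.
have [c Yc] := b_gen g; exists c; split=> [|d]; rewrite bE // => Yd.
apply/eqP; rewrite -subr_eq0; apply/eqP/b_free.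
under eq_bigr => i _ do rewrite !mxE scalerBl.
have := ideal_ofB Yd Yc; congr (ideal_of Y _).
by rewrite sumrB opprB addrC addrA subrK.
Qed.

(** A spanning family with a nontrivial relation stays spanning after removal of
    a member with nonzero coefficient; excluded middle decides at each step
    whether a relation exists. *)
Lemma span_has_length Y n (b : 'I_n -> poly2 K) :
    (forall g, exists c : 'rV_n, Y (g - \sum_i c 0 i *: b i)) ->
  exists k, has_length Y k.
Proof.
elim: n b => [|n IHn] b b_gen.
  by exists 0%N; apply: (has_lengthP (b := b)) => // c _; apply/matrixP=> ? [].
have [b_free|] := EM (forall c : 'rV_n.+1, Y (\sum_i c 0 i *: b i) -> c = 0).
  by exists n.+1; apply: (has_lengthP (b := b)).
move=> /existsNP[c /not_implyP[Yc /eqP/rV0Pn[j cj0]]].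
(* The relation c, scaled by e_j / c_j, cancels the coefficient of b_j. *)
apply: (IHn (fun i => b (lift j i))) => g.
have [e Ye] := b_gen g.
exists (\row_i (e 0 (lift j i) - e 0 j / c 0 j * c 0 (lift j i))).
have := ideal_ofD Ye (ideal_ofZ (e 0 j / c 0 j) Yc); congr (ideal_of Y _).
rewrite -addrA; congr (_ + _).
rewrite (bigD1_ord j) //= [in X in _ + X](bigD1_ord j) //=.
under [in RHS]eq_bigr => i _ do rewrite mxE scalerBl -scalerA.
rewrite sumrB -scaler_sumr scalerDr scalerA divfK // opprD opprB.
by rewrite addrACA addNr add0r addrC.
Qed.

(** Each layer M^n / M^(n+1) is spanned over K by generators of M^n, since
    coefficients count only through their values at P. *)
Lemma fat_point_span n : exists d (b : 'I_d -> poly2 K),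
  forall g, exists c : 'rV_d, fat_point P n (g - \sum_i c 0 i *: b i).
Proof.
elim: n => [|n [d [b b_gen]]]; first by exists 0%N, (fun=> 0) => g; exists 0.
have [e [w [nw wP]]] := fat_point_fingen P n.
exists (d + e)%N.
exists (fun i => match split i with inl j => b j | inr j => w j 0 end).
move=> g; have [c /wP[a Da]] := b_gen g.
exists (row_mx c (\row_j (a 0 j).@[P])).
rewrite big_split_ord /= opprD addrA.
under eq_bigr => i _ do rewrite row_mxEl (unsplitK (inl i)).
rewrite Da mxE -sumrB; apply: (ideal_of_sum (Y := fat_point P n.+1)) => i _.
rewrite row_mxEr (unsplitK (inr i)) mxE.
by have [r nr ->] := fat_pointS_split (a 0 i) (nw i); rewrite addrC addKr.
Qed.

(** The powers of the coordinate functions force every point of Y to be P. *)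
Lemma zero_dim_at_fat Y n : (forall g, fat_point P n g -> Y g) ->
  (forall g, Y g -> g.@[P] = 0) -> zero_dim_at Y P.
Proof.
move=> nY Y0; split.
  have [d [b b_gen]] := fat_point_span n.
  by apply: (span_has_length (b := b)) => g; have [c /nY] := b_gen g; exists c.
move=> Q; split=> [YQ i|QP g /Y0]; last by rewrite (meval_eq _ QP).
have /nY/YQ/eqP : fat_point P n (coor P i ^+ n).
  elim: n {nY} => // n IHn; rewrite exprSr; exact: fat_point_coor.
by rewrite rmorphXn /= mevalB mevalXU mevalC expf_eq0 subr_eq0 => /andP[_ /eqP].
Qed.

End Length.

(** * Order at a point and tangent cones *)

Lemma mpoly_morph_ext (K : comNzRingType) n (S : comNzRingType)
    (phi psi : {rmorphism {mpoly K[n]} -> S}) :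
  (forall c, phi c%:MP = psi c%:MP) -> (forall i, phi 'X_i = psi 'X_i) ->
  phi =1 psi.
Proof.
move=> eqC eqX; elim/mpolyind => [|c m g _ _ IHg]; first by rewrite !rmorph0.
rewrite !rmorphD -mul_mpolyC !rmorphM eqC IHg mpolyXE_id !rmorph_prod.
by congr (_ * _ + _); apply: eq_bigr => i _; rewrite !rmorphXn eqX.
Qed.

Section TangentCone.
Variables (K : fieldType) (P : point2 K).
Implicit Types (g h : poly2 K) (Y Z : subscheme K) (m : 'X_{1..2}).

Lemma recenterB g h : recenter (g - h) P = recenter g P - recenter h P.
Proof. exact: comp_mpolyB. Qed.

Lemma recenterM g h : recenter (g * h) P = recenter g P * recenter h P.
Proof. exact: (rmorphM (comp_mpoly [tuple 'X_i + (P i)%:MP | i < 2])). Qed.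

Lemma recenter_sum (I : Type) (r : seq I) (A : pred I) (F : I -> poly2 K) :
  recenter (\sum_(i <- r | A i) F i) P = \sum_(i <- r | A i) recenter (F i) P.
Proof. exact: raddf_sum. Qed.

Lemma recenterX (i : 'I_2) : recenter 'X_i P = 'X_i + (P i)%:MP.
Proof. by rewrite /recenter comp_mpolyXU nth_mktuple. Qed.

Lemma uncenterX (i : 'I_2) : uncenter 'X_i P = coor P i.
Proof. by rewrite /uncenter comp_mpolyXU nth_mktuple. Qed.

Lemma recenter_coor (i : 'I_2) : recenter (coor P i) P = 'X_i.
Proof.
by rewrite recenterB recenterX [X in _ - X]/recenter comp_mpolyC addrK.
Qed.

Lemma recenterK g : uncenter (recenter g P) P = g.
Proof.
apply: (mpoly_morph_ext
  (phi := comp_mpoly [tuple 'X_i - (P i)%:MP | i < 2]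
           \o comp_mpoly [tuple 'X_i + (P i)%:MP | i < 2]) (psi := idfun)).
- by move=> c /=; rewrite !comp_mpolyC.
move=> i /=; rewrite -/(recenter 'X_i P) recenterX raddfD /= comp_mpolyC.
by rewrite -/(uncenter 'X_i P) uncenterX subrK.
Qed.

Lemma uncenterK g : recenter (uncenter g P) P = g.
Proof.
apply: (mpoly_morph_ext
  (phi := comp_mpoly [tuple 'X_i + (P i)%:MP | i < 2]
           \o comp_mpoly [tuple 'X_i - (P i)%:MP | i < 2]) (psi := idfun)).
- by move=> c /=; rewrite !comp_mpolyC.
move=> i /=; rewrite -/(uncenter 'X_i P) uncenterX -/(recenter _ P).
exact: recenter_coor.
Qed.

(** Membership in M^n is a vanishing condition on the Taylor coefficients at P:
    this is the bridge to the definitions of multiplicity and tangent cone. *)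
Lemma fat_point_coeff n g :
  fat_point P n g <-> forall m, (mdeg m < n)%N -> (recenter g P)@_m = 0.
Proof.
split=> [|g_n].
  elim: n g => // n IHn _ [a [na ->]] m lt_mn.
  rewrite recenter_sum raddf_sum big1 //= => i _.
  rewrite recenterM recenter_coor.
  apply/eqP; rewrite mcoeff_eq0 (perm_mem (msuppMX _ _)).
  apply/negP => /mapP[m' + Dm]; rewrite mcoeff_msupp (IHn _ (na i)) ?eqxx //.
  by move: lt_mn; rewrite Dm mdegD mdeg1 add1n ltnS.
rewrite -(recenterK g) /uncenter comp_mpolyEX; apply: ideal_of_sum_seq => m.
rewrite mcoeff_msupp => gm.
have le_nm : (n <= mdeg m)%N by rewrite leqNgt; apply: contra_neqN gm => /g_n.
apply/ideal_ofZ/(fat_point_leq le_nm); rewrite comp_mpolyX mdegE.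
elim/big_rec2: _ => [|i k h _ kh]; first by [].
apply: fat_pointM => //; rewrite tnth_mktuple.
by elim: (m i) => // e IHe; rewrite exprSr; apply: fat_point_coor.
Qed.

Lemma mcoeff_pihomog d g m :
  (pihomog mdeg d g)@_m = if mdeg m == d then g@_m else 0.
Proof.
elim/mpolyind: g => [|c m' g _ _ IHg].
  by rewrite pihomog0 mcoeff0 if_same.
rewrite linearP /= !(mcoeffD, mcoeffZ) IHg pihomogX mcoeffX.
case: (eqVneq m' m) => [->|ne_m].
  by case: ifP; rewrite ?mcoeffX ?mcoeff0 ?eqxx ?mulr0 ?addr0.
rewrite mulr0 add0r; case: ifP; rewrite ?mcoeffX ?mcoeff0 ?(negPf ne_m);
by rewrite mulr0 add0r.
Qed.

Lemma fat_point_sub_tangent_cone g :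
  fat_point P (mult g P).+1 (g - tangent_cone g P).
Proof.
apply/fat_point_coeff => m; rewrite ltnS => le_m.
rewrite recenterB uncenterK mcoeffB mcoeff_pihomog.
case: eqP => [_|/eqP ne_m]; first exact: subrr.
by rewrite subr0; apply/mcoeff_lt_mlast/lt_mdeg_ltmc; rewrite ltn_neqAle ne_m.
Qed.

Lemma fat_point_mult g : fat_point P (mult g P) g.
Proof.
by apply/fat_point_coeff => m lt_m; apply/mcoeff_lt_mlast/lt_mdeg_ltmc.
Qed.

(** A nonzero form t with g - t of higher order is the initial form of g. *)
Lemma tangent_coneP n g t : t != 0 -> recenter t P \is n.-homog ->
    fat_point P n.+1 (g - t) ->
  mult g P = n /\ tangent_cone g P = t.
Proof.
move=> t0 homt /fat_point_coeff low.
have gE m : (mdeg m <= n)%N -> (recenter g P)@_m = (recenter t P)@_m.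
  move=> /low; rewrite recenterB mcoeffB => /eqP.
  by rewrite subr_eq0 => /eqP.
have rt0 : recenter t P != 0.
  by apply: contra_neq t0 => rt0; rewrite -(recenterK t) rt0 /uncenter raddf0.
have mltn : mdeg (mlast (recenter t P)) = n.
  by apply: (dhomog_mf homt); apply: mlast_supp.
have gmlt : mlast (recenter t P) \in msupp (recenter g P).
  by rewrite mcoeff_msupp gE ?mltn // -mcoeff_msupp mlast_supp.
have multn : mult g P = n.
  apply/eqP; rewrite eqn_leq -{1}mltn lemc_mdeg ?mlast_lemc //= leqNgt.
  have rg0 : recenter g P != 0.
    by apply: contraTneq gmlt => ->; rewrite msupp0.
  apply: contraL (mlast_supp rg0) => lt_n.
  rewrite mcoeff_msupp negbK gE 1?ltnW // (dhomog_nemf_coeff homt) //.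
  by rewrite (ltn_eqF lt_n).
split=> //; rewrite /tangent_cone multn -[RHS]recenterK; congr (uncenter _ P).
apply/mpolyP => m; rewrite mcoeff_pihomog; case: eqP => [Dm|/eqP ne_m].
  by rewrite gE ?Dm.
by rewrite (dhomog_nemf_coeff homt).
Qed.

Lemma mderiv_coor (i j : 'I_2) : (coor P i)^`M(j) = (i == j)%:R.
Proof.
rewrite mderivB mderivC subr0 mderivX mnm1E.
case: eqP => [->|_]; last by rewrite scale0r.
by rewrite scale1r -{1}[U_(j)%MM]add0m addmK mpolyX0.
Qed.

Lemma fat_point_mderiv n g j : fat_point P n.+1 g -> fat_point P n g^`M(j).
Proof.
elim: n g => // n IHn _ [a [na ->]].
rewrite raddf_sum; apply: ideal_of_sum => i _.
rewrite /= mderivM; apply: (ideal_ofD (s := fat_point P n.+1)).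
  exact/fat_point_coor/IHn/na.
by rewrite mderiv_coor; apply: ideal_ofMr; apply: na.
Qed.

End TangentCone.

(** * Products of linear forms *)

Section SeqProd.
Variables (I : eqType) (R : comNzRingType) (F : I -> R).

Lemma big_cofactor_head (j : I) (s : seq I) : j \notin s ->
  \prod_(k <- j :: s | k != j) F k = \prod_(k <- s) F k.
Proof.
move=> js; rewrite big_cons eqxx big_seq_cond [RHS]big_seq.
apply: eq_bigl => k; case: (boolP (k \in s)) => //= ks.
by apply: contraNneq js => <-.
Qed.

Lemma big_cofactor_tail (i j : I) (s : seq I) : j \notin s -> i \in s ->
  \prod_(k <- j :: s | k != i) F k = F j * \prod_(k <- s | k != i) F k.
Proof. by move=> js si; rewrite big_cons (memPnC js). Qed.

Lemma mul_cofactor (i : I) (s : seq I) : uniq s -> i \in s ->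
  F i * \prod_(k <- s | k != i) F k = \prod_(k <- s) F k.
Proof. by move=> Us si; rewrite [RHS](bigD1_seq i). Qed.

End SeqProd.

Lemma mderiv_prod (K : comNzRingType) n (I : finType)
    (F : I -> {mpoly K[n]}) j :
  (\prod_i F i)^`M(j) = \sum_i (F i)^`M(j) * \prod_(k | k != i) F k.
Proof.
elim: (index_enum I) (index_enum_uniq I) => [|i s IHs] /=.
  by rewrite !big_nil -mpolyC1 mderivC.
case/andP=> si Us; rewrite [in LHS]big_cons mderivM IHs // [RHS]big_cons.
rewrite big_cofactor_head //; congr (_ + _).
rewrite mulr_sumr [LHS]big_seq [RHS]big_seq; apply: eq_bigr => k sk.
by rewrite big_cofactor_tail // mulrCA.
Qed.

Section Lines.
Variables (K : fieldType) (P : point2 K).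
Implicit Types (g h : poly2 K) (Y Z : subscheme K) (a b : 'rV[K]_2).

Lemma sum2 (V : nmodType) (F : 'I_2 -> V) : \sum_i F i = F ord0 + F ord_max.
Proof.
by rewrite big_ord_recl big_ord1; congr (_ + F _); apply/val_inj.
Qed.

Lemma ord2P (i : 'I_2) : i = ord0 \/ i = ord_max.
Proof. by case: i => -[|[]] // lt_i2; [left|right]; apply/val_inj. Qed.

Lemma rV2P a b : a 0 ord0 = b 0 ord0 -> a 0 ord_max = b 0 ord_max -> a = b.
Proof. by move=> ? ?; apply/rowP => i; have [] := ord2P i => ->. Qed.

(** The 2 x 2 determinant of two normal vectors.  It vanishes exactly when the
    lines coincide, and it is also the value of the linear form of a on the
    direction (b_1, - b_0) of the line of b. *)
Definition wedge a b := a 0 ord0 * b 0 ord_max - a 0 ord_max * b 0 ord0.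

Lemma wedge_same_line a b : a != 0 -> b != 0 -> wedge a b = 0 -> same_line a b.
Proof.
move=> a0 /rV0Pn[i bi] /eqP; rewrite subr_eq0 => /eqP ab.
have Da : a = a 0 i / b 0 i *: b.
  apply: rV2P; rewrite !mxE; apply: (mulIf bi); rewrite mulrAC divfK //.
    by case: (ord2P i) => -> //; rewrite ab.
  by case: (ord2P i) => -> //; rewrite ab.
exists (a 0 i / b 0 i) => //.
by apply: contraNneq a0 => c0; rewrite Da c0 scale0r.
Qed.

Lemma wedge_trans a b c :
  c != 0 -> wedge a c = 0 -> wedge b c = 0 -> wedge a b = 0.
Proof.
move=> /rV0Pn[i ci] ac bc; apply: (mulIf ci); rewrite mul0r.
have -> : wedge a b * c 0 i = a 0 i * - wedge b c + b 0 i * wedge a c.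
  by rewrite /wedge; case: (ord2P i) => ->; ring.
by rewrite ac bc oppr0 !mulr0 addr0.
Qed.

Lemma wedge_dual a : a != 0 -> exists b, wedge b a = 1.
Proof.
move=> /rV0Pn[i ai]; have [] := ord2P i => Di; rewrite Di in ai.
  exists (\row_j if j == ord0 then 0 else - (a 0 ord0)^-1).
  by rewrite /wedge !mxE /= mul0r sub0r mulNr opprK mulVf.
exists (\row_j if j == ord0 then (a 0 ord_max)^-1 else 0).
by rewrite /wedge !mxE /= mul0r subr0 mulVf.
Qed.

Lemma line_eqE a :
  line_eq P a = a 0 ord0 *: coor P ord0 + a 0 ord_max *: coor P ord_max.
Proof. by rewrite /line_eq sum2. Qed.

Lemma coor_span a b i : wedge a b != 0 ->
  exists u v, coor P i = u *: line_eq P a + v *: line_eq P b.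
Proof.
move=> ab; have lin u v : u *: line_eq P a + v *: line_eq P b =
    (u * a 0 ord0 + v * b 0 ord0) *: coor P ord0
    + (u * a 0 ord_max + v * b 0 ord_max) *: coor P ord_max.
  rewrite !line_eqE; move: (coor P ord0) (coor P ord_max) => x y.
  by rewrite !scalerDr !scalerA !scalerDl addrACA.
have [] := ord2P i => ->.
  exists (b 0 ord_max / wedge a b), (- a 0 ord_max / wedge a b).
  rewrite lin -[LHS]scale1r -[LHS]addr0 -(scale0r (coor P ord_max)).
  by congr (_ *: _ + _ *: _); move: ab; rewrite /wedge => ab; field.
exists (- b 0 ord0 / wedge a b), (a 0 ord0 / wedge a b).
rewrite lin -[LHS]scale1r -[LHS]add0r -(scale0r (coor P ord0)).
by congr (_ *: _ + _ *: _); move: ab; rewrite /wedge => ab; field.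
Qed.

Lemma fat_point_line a : fat_point P 1 (line_eq P a).
Proof.
apply: (ideal_of_sum (Y := fat_point P 1)) => i _; apply: ideal_ofZ.
by rewrite -/(coor P i) -[coor P i]mul1r; apply: fat_point_coor.
Qed.

Lemma recenter_line_homog a : recenter (line_eq P a) P \is 1.-homog.
Proof.
rewrite recenter_sum; apply: rpred_sum => i _.
rewrite /recenter comp_mpolyZ; apply: rpredZ.
by rewrite -/(recenter (coor P i) P) recenter_coor dhomogX /= mdeg1.
Qed.

Lemma mderiv_line a j : (line_eq P a)^`M(j) = (a 0 j)%:MP.
Proof.
rewrite /line_eq raddf_sum /= (bigD1 j) //= big1 ?addr0 => [|i ne_ij].
  by rewrite mderivZ -/(coor P j) mderiv_coor eqxx -mul_mpolyC mulr1.
by rewrite mderivZ -/(coor P i) mderiv_coor (negPf ne_ij) scaler0.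
Qed.

Section Product.
Variables (I : finType) (a : I -> 'rV[K]_2).

Lemma fat_point_prod_line (A : pred I) :
  fat_point P #|A| (\prod_(k | A k) line_eq P (a k)).
Proof.
rewrite -sum1_card; elim/big_rec2: _ => // k n g _ ng.
by apply: fat_pointM => //; apply: fat_point_line.
Qed.

Lemma prod_line_homog (A : pred I) :
  recenter (\prod_(k | A k) line_eq P (a k)) P \is #|A|.-homog.
Proof.
have -> : recenter (\prod_(k | A k) line_eq P (a k)) P =
    \prod_(k | A k) recenter (line_eq P (a k)) P.
  exact: (rmorph_prod (comp_mpoly [tuple 'X_i + (P i)%:MP | i < 2])).
rewrite -sum1_card; elim/big_rec2: _ => [|k n g _ ng]; first exact: dhomog1.
by apply: dhomogM => //; apply: recenter_line_homog.
Qed.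

Hypothesis a_distinct : forall i j, i != j -> wedge (a i) (a j) != 0.

(** Induction on the lines: let the line j be added to a family s, and let G' be
    the cofactor of i in s.  A coordinate is a combination of l_j and l_i;
    l_j G' is the new cofactor of i, and l_i G' = prod_s l is the new cofactor
    of j.  So (Y : coordinate) contains the old cofactors. *)
Lemma cofactor_ideal_seq (s : seq I) Y : uniq s -> s != [::] ->
    (forall i, i \in s -> Y (\prod_(k <- s | k != i) line_eq P (a k))) ->
  forall g, fat_point P (size s).-1 g -> Y g.
Proof.
elim: s Y => // j [|j' s] IHs Y /andP[js Us] _ YG g.
  move=> _; rewrite -[g]mulr1; apply: ideal_ofM.
  by have := YG j; rewrite mem_head big_cofactor_head // big_nil; apply.
case=> b [nb ->]; apply: ideal_of_sum => e _.
apply: (IHs (colon Y (coor P e))) (nb e) => // i si; rewrite /colon /=.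
have ne_ji : j != i by apply: contraNneq js => ->.
have [u [v ->]] := coor_span e (a_distinct ne_ji).
rewrite mulrDr -!scalerAr; apply: ideal_ofD; apply: ideal_ofZ.
  have := YG i; rewrite inE si orbT mulrC big_cofactor_tail //; exact.
have := YG j; rewrite mem_head mulrC.
rewrite (mul_cofactor (fun k => line_eq P (a k))) // big_cofactor_head //.
exact.
Qed.

Lemma cofactor_ideal Y : (0 < #|I|)%N ->
    (forall i, Y (\prod_(k | k != i) line_eq P (a k))) ->
  forall g, fat_point P #|I|.-1 g -> Y g.
Proof.
move=> I0 YG g; rewrite cardE enumT => ng.
apply: (cofactor_ideal_seq (index_enum_uniq I)) ng => //.
by rewrite -size_eq0 -lt0n -[index_enum I]enumT -cardT.
Qed.

End Product.

(** * Restriction to a line *)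

(** The pullback along t |-> P + t (a_1, - a_0), a parametrization of the line
    through P with normal vector a. *)
Definition restr a : poly2 K -> {poly K} :=
  mmap polyC
    (fun i => (P i)%:P + (if i == ord0 then a 0 ord_max else - a 0 ord0) *: 'X).

HB.instance Definition _ a := GRing.RMorphism.on (restr a).

Lemma restrC a c : restr a c%:MP = c%:P.
Proof. exact: mmapC. Qed.

Lemma restr_coor a i : restr a (coor P i) =
  (if i == ord0 then a 0 ord_max else - a 0 ord0) *: 'X.
Proof. by rewrite rmorphB /= restrC /restr mmapX mmap1U addrAC subrr add0r. Qed.

Lemma restrZ a c g : restr a (c *: g) = c *: restr a g.
Proof. by rewrite -mul_mpolyC rmorphM /= restrC mul_polyC. Qed.

Lemma restr_line a b : restr a (line_eq P b) = wedge b a *: 'X.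
Proof.
rewrite line_eqE rmorphD /= !restrZ !restr_coor /= !scalerA -scalerDl.
by rewrite /wedge mulrN.
Qed.

Lemma restr_line_self a : restr a (line_eq P a) = 0.
Proof. by rewrite restr_line /wedge mulrC subrr scale0r. Qed.

Lemma restr_coef0 a g : (restr a g)`_0 = g.@[P].
Proof.
rewrite -horner_coef0 -[LHS]/(horner_eval 0 (restr a g)).
apply: (mpoly_morph_ext (phi := horner_eval 0 \o restr a) (psi := meval P)).
  by move=> c; rewrite /= restrC mevalC /horner_eval hornerC.
move=> i; rewrite /= mevalXU /horner_eval /restr mmapX mmap1U.
by rewrite hornerD hornerZ hornerC hornerX mulr0 addr0.
Qed.

Lemma restr_fat_point a n g : fat_point P n g -> exists q, restr a g = q * 'X^n.
Proof.
elim: n g => [|n IHn] g; first by exists (restr a g); rewrite mulr1.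
case=> b [nb ->]; rewrite rmorph_sum /=; elim/big_rec: _ => [|i r _ [q ->]].
  by exists 0; rewrite mul0r.
have [q' Dq'] := IHn _ (nb i).
exists (q' * (if i == ord0 then a 0 ord_max else - a 0 ord0)%:P + q).
by rewrite rmorphM /= Dq' restr_coor -mul_polyC exprS; ring.
Qed.

Lemma curve_line a g : curve (line_eq P a) (g * line_eq P a).
Proof. by apply/ideal_ofM/zero_scheme_mem; rewrite inE. Qed.

Lemma curve_restr a g : curve (line_eq P a) g -> restr a g = 0.
Proof.
case=> c ->; rewrite rmorph_sum big1 // => -[[|] //= lt] _.
by rewrite rmorphM /= restr_line_self mulr0.
Qed.

(** The vector b is normalized so that s restricts to the parameter t of the
    line l = 0; then s and l are local coordinates at P. *)
Section LineSection.
Variables (a b : 'rV[K]_2).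
Hypothesis ba : wedge b a = 1.
Let s := line_eq P b.
Let l := line_eq P a.

Lemma fat_point_param n : fat_point P n (s ^+ n).
Proof.
elim: n => // n IHn; rewrite exprSr -addn1; apply: fat_pointM => //.
exact: fat_point_line.
Qed.

Lemma fat_point_mod_line n g : fat_point P n g ->
  exists w q, g = w * s ^+ n + q * l.
Proof.
elim: n g => [|n IHn] g; first by exists g, 0; rewrite mulr1 mul0r addr0.
case=> c [nc ->]; elim/big_rec: _ => [|i r _ [w [q ->]]].
  by exists 0, 0; rewrite !mul0r addr0.
have [w' [q' ->]] := IHn _ (nc i).
have ba0 : wedge b a != 0 by rewrite ba oner_neq0.
have [u [v ->]] := coor_span i ba0; rewrite -/s -/l -!mul_mpolyC.
exists (w' * u%:MP + w).
exists (q' * u%:MP * s + w' * s ^+ n * v%:MP + q' * v%:MP * l + q).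
by rewrite exprS; ring.
Qed.

(** Taylor expansion of the restriction to the line, lifted to the plane. *)
Lemma taylor_mod_line n g : exists c : nat -> K,
  inter (curve l) (fat_point P n) (g - \sum_(i < n) c i *: s ^+ i).
Proof.
elim: n => [|n [c [p [r [Lp nr Dg]]]]].
  by exists (fun=> 0); apply: inter_r.
have [w [q' Dr]] := fat_point_mod_line nr.
have [t nt Dw] := fat_pointS_split w (fat_point_param n).
exists (fun i => if i == n then w.@[P] else c i).
rewrite big_ord_recr /= eqxx.
under eq_bigr => i _ do rewrite (ltn_eqF (ltn_ord i)).
rewrite opprD addrA Dg Dr Dw; exists (p + q' * l), t.
split=> //; last by ring.
by apply: ideal_ofD => //; apply: curve_line.
Qed.

(** Modulo l, F is s^k times a factor w with w(P) != 0, so s^k, and hence M^k,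
    lies in Y + (l) + M^(k+1).  The error term is pushed to ever higher order
    until M^N, which lies in Y, absorbs it. *)
Lemma fat_point_sub_line_section Y k F : Y F -> fat_point P k F ->
    (restr a F)`_k != 0 -> (exists N, forall g, fat_point P N g -> Y g) ->
  forall g, fat_point P k g -> inter Y (curve l) g.
Proof.
move=> YF kF Fk [N NY]; set I := inter Y (curve l).
(* s^(k+e) = w(P)^-1 F s^e modulo l and higher order. *)
have sI e : inter I (fat_point P (k + e).+1) (s ^+ (k + e)).
  have [w [q DF]] := fat_point_mod_line kF.
  have wP : w.@[P] != 0.
    move: Fk; rewrite DF rmorphD !rmorphM rmorphXn /= restr_line_self.
    by rewrite mulr0 addr0 restr_line ba scale1r coefMXn ltnn subnn restr_coef0.
  have [r nr Dw] := fat_pointS_split w (fat_point_param (k + e)).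
  have -> : s ^+ (k + e) =
     (w.@[P])^-1 *: (F * s ^+ e - q * s ^+ e * l) - (w.@[P])^-1 *: r.
    have -> : F * s ^+ e - q * s ^+ e * l = w * s ^+ (k + e).
      by rewrite DF exprD; ring.
    by rewrite Dw scalerDr addrK scalerA mulVf ?scale1r.
  apply: ideal_ofB; [apply: inter_l|apply: inter_r]; last exact: ideal_ofZ.
  apply/ideal_ofZ/ideal_ofB; last exact/inter_r/curve_line.
  by apply/inter_l/ideal_ofMr.
(* Descending induction on the order j; d bounds the distance from j to N. *)
have jI d j : (k <= j)%N -> (N <= j + d)%N -> forall g, fat_point P j g -> I g.
  elim: d j => [|d IHd] j le_kj le_Nj g jg.
    by apply/inter_l/NY/(fat_point_leq _ jg); rewrite -[j]addn0.
  have [w [q ->]] := fat_point_mod_line jg.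
  apply: ideal_ofD; last exact/inter_r/curve_line.
  apply: ideal_ofM; have := sI (j - k)%N; rewrite subnKC //.
  apply: inter_sub => // h; apply: IHd; first exact: leqW.
  by rewrite addSnnS.
by apply: (jI N); rewrite ?leq_addl.
Qed.

(** The powers 1, s, ..., s^(k-1) are a basis: they span by Taylor expansion and
    the previous lemma, and are independent since a relation would restrict to a
    polynomial of degree less than k divisible by t^k. *)
Lemma line_section_length Y k F : Y F -> fat_point P k F ->
    (restr a F)`_k != 0 -> (exists N, forall g, fat_point P N g -> Y g) ->
    (forall g, Y g -> exists q, restr a g = q * 'X^k) ->
  has_length (inter Y (curve l)) k.
Proof.
move=> YF kF Fk NY Yk; apply: (has_lengthP (b := fun i : 'I_k => s ^+ i)).
  move=> c [g [h [/Yk[q Dg] /curve_restr h0 /(congr1 (restr a))]]].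
  rewrite rmorphD /= h0 addr0 Dg rmorph_sum /= => Dc; apply/rowP => i.
  move/(congr1 (coefp i)): Dc; rewrite /= coefMXn ltn_ord mxE => <-.
  rewrite coef_sum (bigD1 i) //= big1 ?addr0 => [|j ne_ji].
    by rewrite restrZ rmorphXn /= restr_line ba scale1r coefZ coefXn eqxx mulr1.
  rewrite restrZ rmorphXn /= restr_line ba scale1r coefZ coefXn.
  by rewrite eq_sym -val_eqE /= in ne_ji; rewrite (negPf ne_ji) mulr0.
move=> g; have [c cP] := taylor_mod_line k g; exists (\row_i c i).
under eq_bigr => i _ do rewrite mxE.
apply: inter_sub cP => h; first exact: inter_r.
by move=> kh; apply: (fat_point_sub_line_section YF kF Fk NY kh).
Qed.

End LineSection.

End Lines.

(** * Ordinary points *)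

Section OrdinaryPoint.
Variables (K : fieldType) (P : point2 K).
Variables (n : nat) (c : K) (a : 'I_n.+1 -> 'rV[K]_2).
Hypotheses (n_gt0 : (0 < n)%N) (char_n : n.+1%:R != 0 :> K) (c_neq0 : c != 0).
Hypotheses (a_neq0 : forall i, a i != 0)
  (a_distinct : forall i j, i != j -> wedge (a i) (a j) != 0).
Implicit Types (g h : poly2 K) (Y Z : subscheme K) (b : 'rV[K]_2).

Let T : poly2 K := c *: \prod_i line_eq P (a i).
Let G i : poly2 K := \prod_(k | k != i) line_eq P (a k).
Let D b i : K := \prod_(k | k != i) wedge (a k) b.

Let card_others (i : 'I_n.+1) : #|[pred k | k != i]| = n.
Proof. by have := cardC1 i; rewrite card_ord. Qed.

Lemma mderiv_cone j : T^`M(j) = c *: \sum_i (a i 0 j) *: G i.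
Proof.
rewrite mderivZ mderiv_prod; congr (_ *: _); apply: eq_bigr => i _.
by rewrite mderiv_line mul_mpolyC.
Qed.

Lemma recenter_mderiv_cone_homog j : recenter T^`M(j) P \is n.-homog.
Proof.
rewrite mderiv_cone /recenter comp_mpolyZ; apply: rpredZ.
rewrite raddf_sum; apply: rpred_sum => i _ /=.
rewrite comp_mpolyZ; apply: rpredZ.
by have := prod_line_homog P a (fun k => k != i); rewrite card_others.
Qed.

Lemma fat_point_cofactor i : fat_point P n (G i).
Proof.
by have := fat_point_prod_line P a (fun k => k != i); rewrite card_others.
Qed.

(** The value of T_j / c at the direction of the line with normal vector b. *)
Let slope b j : K := \sum_i a i 0 j * D b i.

Lemma restr_mderiv_cone b j : restr P b T^`M(j) = (c * slope b j) *: 'X^n.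
Proof.
rewrite mderiv_cone restrZ rmorph_sum -scalerA scaler_suml; congr (_ *: _).
apply: eq_bigr => i _; rewrite /= restrZ rmorph_prod -scalerA; congr (_ *: _).
under eq_bigr => k _ do rewrite /= restr_line.
by rewrite scaler_prod prodr_const card_others.
Qed.

Lemma slope_on_cone b i j : b != 0 -> wedge (a i) b = 0 ->
  slope b j = a i 0 j * D b i /\ D b i != 0.
Proof.
move=> b0 ib; split.
  rewrite /slope (bigD1 i) //= big1 ?addr0 // => k ne_ki.
  by rewrite /D (bigD1 i) 1?eq_sym //= ib mul0r mulr0.
apply/prodf_neq0 => k ne_ki; apply: contra_neq (a_distinct ne_ki) => kb.
exact: wedge_trans b0 kb ib.
Qed.

(** Off the cone, b_1 slope_0 - b_0 slope_1 is Euler's sum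
    sum_i l_i G_i = (n + 1) prod_i l_i at the direction of b, which is nonzero
    because n + 1 is invertible. *)
Lemma slope_neq0 b : b != 0 -> exists j, slope b j != 0.
Proof.
move=> b0; have [[i ib]|nb] := pselect (exists i, wedge (a i) b = 0).
  have /rV0Pn[j aij] := a_neq0 i; exists j.
  by have [-> Di] := slope_on_cone j b0 ib; rewrite mulf_neq0.
apply: contrapT => /forallNP slope0.
have {}slope0 j : slope b j = 0 by apply/eqP/negP=> /negP /slope0.
have : b 0 ord_max * slope b ord0 - b 0 ord0 * slope b ord_max
       = n.+1%:R * \prod_i wedge (a i) b.
  have wD i : b 0 ord_max * (a i 0 ord0 * D b i)
      - b 0 ord0 * (a i 0 ord_max * D b i) = \prod_k wedge (a k) b.
    by rewrite [RHS](bigD1 i) //= -/(D b i) /wedge; ring.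
  rewrite !mulr_sumr -sumrB (eq_bigr _ (fun i _ => wD i)).
  by rewrite sumr_const card_ord mulr_natl.
rewrite !slope0 !mulr0 subr0 => /esym/eqP; rewrite mulf_eq0 (negPf char_n) /=.
by case/prodf_eq0 => i _ /eqP ib; apply: nb; exists i.
Qed.

(** A zero derivative would make every slope zero; on the line of a_i the slope
    is a nonzero multiple of the j-th coefficient of a_i, and these coefficients
    cannot vanish for two distinct lines. *)
Lemma mderiv_cone_neq0 j : T^`M(j) != 0.
Proof.
have [i aij] : exists i, a i 0 j != 0.
  have ne01 : ord0 != ord_max :> 'I_n.+1 by rewrite -val_eqE /= eq_sym -lt0n.
  have := a_distinct ne01; apply: contraNP => /forallNP aj0.
  have {}aj0 i : a i 0 j = 0 by apply/eqP/negP=> /negP /aj0.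
  rewrite /wedge; case: (ord2P j) aj0 => -> aj0;
  by rewrite !aj0 !(mul0r, mulr0) subrr.
have ii : wedge (a i) (a i) = 0 by rewrite /wedge mulrC subrr.
apply: contra_neq (mulf_neq0 c_neq0 aij) => Tj0.
have [Ds Di] := slope_on_cone j (a_neq0 i) ii.
have := restr_mderiv_cone (a i) j; rewrite Tj0 rmorph0 Ds => /esym/eqP.
rewrite scaler_eq0 -size_poly_eq0 size_polyXn orbF mulrA mulf_eq0.
by rewrite (negPf Di) orbF => /eqP.
Qed.

Lemma euler_cone : \sum_j coor P j * T^`M(j) = n.+1%:R *: T.
Proof.
rewrite sum2 !mderiv_cone -!scalerAr -scalerDr.
rewrite /T [RHS]scalerA [_ * c]mulrC -[RHS]scalerA.
congr (_ *: _); rewrite !mulr_sumr -big_split /=.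
have lG i : coor P ord0 * (a i 0 ord0 *: G i)
    + coor P ord_max * (a i 0 ord_max *: G i) = \prod_k line_eq P (a k).
  by rewrite [RHS](bigD1 i) //= -/(G i) line_eqE -!mul_mpolyC; ring.
rewrite (eq_bigr _ (fun i _ => lG i)).
by rewrite sumr_const card_ord scaler_nat.
Qed.

(** All that matters about the derivatives of f is their initial forms. *)
Section Partials.
Variable F : 'I_2 -> poly2 K.
Hypothesis FT : forall j, fat_point P n.+1 (F j - T^`M(j)).

Lemma fat_point_partial j : fat_point P n (F j).
Proof.
rewrite -[F j](subrK T^`M(j)); apply: ideal_ofD.
  exact: fat_point_leq (leqnSn n) (FT j).
rewrite mderiv_cone; apply/ideal_ofZ/ideal_of_sum => i _; apply: ideal_ofZ.
exact: fat_point_cofactor.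
Qed.

Lemma restr_partial_coef b j : (restr P b (F j))`_n = c * slope b j.
Proof.
rewrite -[F j](subrK T^`M(j)) rmorphD /= restr_mderiv_cone coefD.
have [q ->] := restr_fat_point b (FT j).
by rewrite coefMXn ltnSn add0r coefZ coefXn eqxx mulr1.
Qed.

Lemma partial_tangent_cone j :
  mult (F j) P = n /\ tangent_cone (F j) P = T^`M(j).
Proof.
apply: tangent_coneP (FT j); first exact: mderiv_cone_neq0.
exact: recenter_mderiv_cone_homog.
Qed.

Lemma partials_no_common_tangent :
  no_common_tangent (F ord0) (F ord_max) P.
Proof.
move=> b b0 []; have tc := partial_tangent_cone.
rewrite !(tc _).2 => -[q0 T0] [q1 T1].
have [j /negP[]] := slope_neq0 b0; apply/eqP/(mulfI c_neq0).
have := restr_mderiv_cone b j; rewrite mulr0.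
have -> : restr P b T^`M(j) = 0.
  by case: (ord2P j) => ->; rewrite ?T0 ?T1 rmorphM /= restr_line_self mulr0.
by move/(congr1 (coefp n)); rewrite /= coef0 coefZ coefXn eqxx mulr1.
Qed.

Lemma partial_is_curve j : is_curve (F j).
Proof.
rewrite /is_curve ltnNge; apply/negP => /msize1_polyC DF.
have F0 : F j = 0.
  have := fat_point_eval n_gt0 (fat_point_partial j).
  by rewrite DF mevalC => ->; rewrite mpolyC0.
have := (partial_tangent_cone j).1.
rewrite F0 /mult /recenter comp_mpoly0 mlast0 mdeg0 => n0.
by move: n_gt0; rewrite -n0.
Qed.

(** The products G_i G_j lie in Y + M^(2n+1), and they generate M^(2n)
    because the G_i generate M^n. *)
Lemma fat_point_sub_jets Y : (forall j, Y (F j)) ->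
  forall g, fat_point P (n + n) g -> inter Y (fat_point P (n + n).+1) g.
Proof.
move=> YF.
pose J k := inter Y (fat_point P k).
have JM k k' g h : J k g -> fat_point P k' h -> J (k' + k)%N (h * g).
  move=> [u [v [Yu kv ->]]] k'h; rewrite mulrDr.
  apply: ideal_ofD; [exact/inter_l/ideal_ofM | exact/inter_r/fat_pointM].
have JT j : J n.+1 T^`M(j).
  rewrite -[T^`M(j)](subKr (F j)); apply: ideal_ofB; first exact/inter_l/YF.
  exact/inter_r/FT.
have coor1 j : fat_point P 1 (coor P j).
  by rewrite -[coor P j]mul1r; apply: fat_point_coor.
have JL : J n.+2 (\prod_i line_eq P (a i)).
  have cn0 : n.+1%:R * c != 0 by rewrite mulf_neq0.
  rewrite -[\prod_i _](scalerK cn0) -scalerA -/T -euler_cone.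
  by apply/ideal_ofZ/ideal_of_sum => j _; apply: (JM n.+1 1%N).
have nG := fat_point_cofactor.
have JGG i j : i != j -> J (n + n).+1 (G i * G j).
  move=> ne_ij; pose H := \prod_(k | (k != i) && (k != j)) line_eq P (a k).
  have -> : G i * G j = H * \prod_i line_eq P (a i).
    rewrite (bigD1 i) //= -/(G i) mulrA [RHS]mulrC; congr (_ * _).
    rewrite /G (bigD1 i) //= mulrC; congr (_ * _).
    by apply: eq_bigl => k; rewrite andbC.
  have nH : fat_point P n.-1 H.
    have := fat_point_prod_line P a (fun k => (k != i) && (k != j)).
    suff -> : #|[pred k | (k != i) && (k != j)]| = n.-1 by [].
    have := card_others i; rewrite (cardD1 j) inE eq_sym ne_ij add1n.
    move=> /(congr1 predn) /= <-.
    by apply: eq_card => k; rewrite !inE andbC.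
  have := JM _ _ _ _ JL nH; congr (J _ _).
  by rewrite -{3}(prednK n_gt0) addSnnS addnS addnS.
(* G_i T_j = c a_ij G_i^2 + mixed products, for a j with a_ij != 0. *)
have JG2 i : J (n + n).+1 (G i * G i).
  have /rV0Pn[j aij] := a_neq0 i.
  have cc : c * a i 0 j != 0 by rewrite mulf_neq0.
  have -> : G i * G i = (c * a i 0 j)^-1 *:
      (G i * T^`M(j) - c *: \sum_(k | k != i) a k 0 j *: (G i * G k)).
    apply: (canRL (scalerK cc)).
    rewrite mderiv_cone -scalerAr -scalerBr -scalerA; congr (_ *: _).
    rewrite mulr_sumr (bigD1 i) //= -scalerAr.
    under [X in _ + X - _]eq_bigr => k _ do rewrite -scalerAr.
    by rewrite addrK.
  apply/ideal_ofZ/ideal_ofB; first by rewrite -addnS; apply: JM.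
  apply/ideal_ofZ/ideal_of_sum => k ne_ki.
  by apply/ideal_ofZ/JGG; rewrite eq_sym.
have JGG' i j : J (n + n).+1 (G i * G j).
  by have [->|/JGG] := eqVneq i j.
have interp Z : (forall i, Z (G i)) -> forall g, fat_point P n g -> Z g.
  have := cofactor_ideal a_distinct (Y := Z); rewrite card_ord; exact.
apply: (fat_point_prod_ind (Y := J (n + n).+1)) => g h ng nh.
apply: (interp (colon (J (n + n).+1) h)) ng => i; rewrite /colon /= mulrC.
by apply: (interp (colon (J (n + n).+1) (G i))) nh => k; apply: JGG'.
Qed.

Lemma fat_point_sub_component Y : (forall j, Y (F j)) ->
  forall g, fat_point P (n + n) g -> component Y P g.
Proof. by move=> YF; apply/nakayama/fat_point_sub_jets. Qed.

Lemma component_zero_dim Y : (forall j, Y (F j)) ->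
  (forall g, Y g -> g.@[P] = 0) -> zero_dim_at (component Y P) P.
Proof.
move=> YF Y0; apply: zero_dim_at_fat (fat_point_sub_component YF) _.
move=> g [h [hP /Y0/eqP]].
by rewrite mevalM mulf_eq0 (negPf hP) => /eqP.
Qed.

(** The denominator h of an element g of the component is a unit at P, so its
    restriction is prime to t and t^n divides the restriction of g itself. *)
Lemma component_symmetric Y : (forall j, Y (F j)) ->
  (forall g, Y g -> fat_point P n g) -> symmetric_at n (component Y P) P.
Proof.
move=> YF Yn; split=> [|b b0].
  by apply: component_zero_dim => // g /Yn; apply: fat_point_eval.
(* F_j restricts to t^n times a unit on the line as soon as its slope there
   is nonzero. *)
have [d db] := wedge_dual b0; have [j sj] := slope_neq0 b0.
apply: (line_section_length (F := F j) db).
- exact/sub_component/YF.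
- exact: fat_point_partial.
- by rewrite restr_partial_coef mulf_neq0.
- by exists (n + n)%N; apply: fat_point_sub_component.
move=> g [h [hP /Yn/(restr_fat_point b)[q]]]; rewrite rmorphM /= => Dq.
have : 'X^n %| restr P b h * restr P b g by rewrite Dq dvdp_mull.
rewrite Gauss_dvdpr; first by case/dvdpP=> q' ->; exists q'.
apply: coprimep_expl; rewrite coprimep_sym coprimepX.
by rewrite rootE horner_coef0 restr_coef0.
Qed.

End Partials.
End OrdinaryPoint.

Lemma eq_milnor_inter (K : fieldType) (f : poly2 K) (P : point2 K) :
  eq_subscheme (component (milnor_scheme f) P)
    (component (inter (curve (f_x f)) (curve (f_y f))) P).
Proof.
move=> g; split; apply: component_sub => {}g.
  apply: zero_scheme_sub => h; rewrite !inE => /orP[] /eqP->.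
    by apply/inter_l/zero_scheme_mem; rewrite inE.
  by apply/inter_r/zero_scheme_mem; rewrite inE.
by apply: inter_sub => {}g; apply: zero_scheme_sub => h; rewrite inE => /eqP->;
  apply: zero_scheme_mem; rewrite !inE eqxx ?orbT.
Qed.

Theorem theorem4p5 (R : realType) (f : {mpoly R[i][2]}) (P : 'I_2 -> R[i])
    (m : nat) :
  is_curve f -> reduced (curve f) ->
  (2 <= m)%N -> ordinary_point f P m ->
  let Z_P := component (milnor_scheme f) P in
  let X_P := component (jacobian_scheme f) P in
  [/\ no_common_tangent (f_x f) (f_y f) P,
      eq_subscheme Z_P (component (inter (curve (f_x f)) (curve (f_y f))) P),
      slci_at m.-1 Z_P P
    & symmetric_at m.-1 X_P P].
Proof.
move=> _ _; case: m => // n n_gt0 [multf [c [a [c0 a0 a_lines Tf]]]] Z_P X_P /=.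
have a_dist i j : i != j -> wedge (a i) (a j) != 0.
  move=> /a_lines a_ij; apply: contra_notN a_ij => /eqP.
  exact: wedge_same_line.
have char_n : n.+1%:R != 0 :> R[i] by rewrite Num.Theory.pnatr_eq0.
pose F j := f^`M(j).
have FT j : fat_point P n.+1 (F j - (c *: \prod_i line_eq P (a i))^`M(j)).
  rewrite -mderivB -Tf; apply: fat_point_mderiv; rewrite -multf.
  exact: fat_point_sub_tangent_cone.
have nct := partials_no_common_tangent n_gt0 char_n c0 a0 a_dist FT.
have nF := fat_point_partial FT.
have MF j : milnor_scheme f (F j).
  by apply: zero_scheme_mem; case: (ord2P j) => ->; rewrite !inE eqxx ?orbT.
have JF j : jacobian_scheme f (F j).
  by apply: zero_scheme_mem; case: (ord2P j) => ->; rewrite !inE eqxx ?orbT.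
split=> //; first exact: eq_milnor_inter.
  split.
    apply: (component_zero_dim n_gt0 char_n c0 a0 a_dist FT MF) => g.
    have : forall h, milnor_scheme f h -> fat_point P n h.
      by apply: zero_scheme_sub => h; rewrite !inE => /orP[] /eqP->; apply: nF.
    by move=> Mn /Mn; apply: fat_point_eval.
  have tc := partial_tangent_cone n_gt0 c0 a0 a_dist FT.
  have crv := partial_is_curve n_gt0 c0 a0 a_dist FT.
  exists (f_x f), (f_y f); split=> //; last exact: eq_milnor_inter.
    by split; apply: crv.
  by split; [apply: (tc ord0).1 | apply: (tc ord_max).1].
apply: (component_symmetric n_gt0 char_n c0 a0 a_dist FT JF) => g.
apply: zero_scheme_sub => h; rewrite !inE => /or3P[] /eqP->; [|exact: nF..].
apply: (fat_point_leq (leqnSn n)); rewrite -[in X in fat_point _ X]multf.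
exact: fat_point_mult.
Qed.
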